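(* Let $F$ be a feature set, $T$ a training set, $c^*:X\to Y$ the target classification function, and $\mathcal{L}$ a consistent learning algorithm. If there is a training set prediction error for $T$, $F$, $\mathcal{L}$, then the error must be a mislabeling error or a representation error; that is, either there is a labeled example $(x,y)\in T$ with $y\neq c^*(x)$, or for every $c\in\mathcal{C}(F,\mathcal{L})$ there is $(x,y)\in T$ with $c(x)\neq c^*(x)$.
   Context: $X$ is a set of objects, $Y$ a set of labels; a classification function is a map $X\to Y$, and $\mathcal{C}$ is the set of all of them. The target classification function $c^*\in\mathcal{C}$ is fixed. A feature is a function $X\to\mathbb{R}$; a fixed set $R$ of (teachable) features is given, and a feature set is a finite subset $F=\{f_1,\dots,f_p\}$ of $R$, which maps $x\in X$ to $F(x)=(f_1(x),\dots,f_p(x))\in\mathbb{R}^p$, where $p=|F|$. A training set is a finite set $T\subset X\times Y$; write $T_X=\{x\mid (x,y)\in T\}$. A classification function $c$ is consistent with $T$ if $c(x)=y$ for all $(x,y)\in T$. A $d$-dimensional learning algorithm $\ell_d$ takes a $d$-dimensional feature set $F$ and a training set $T$ and outputs a function $\mathbb{R}^d\to Y$; its hypothesis space $H_d$ is the image of $\ell_d$. It is consistent if, for all $d$-dimensional $F$ and all $T$, whenever there is $h\in H_d$ such that $h\circ F$ is consistent with $T$, the function $\ell_d(F,T)\circ F$ is consistent with $T$. A vector learning algorithm is a family $\ell=\{\ell_0,\ell_1,\dots\}$ of $d$-dimensional learning algorithms, one for each $d$; it is consistent if every $\ell_d$ is. The associated learning algorithm is $\mathcal{L}(F,T)=\ell_{|F|}(F,T)\circ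 F\in\mathcal{C}$; it is called consistent if $\ell$ is. $\mathcal{C}(F,\mathcal{L})$ is the set of $c\in\mathcal{C}$ for which there is a training set $S$ with $\mathcal{L}(F,S)=c$. A training set prediction error for $T,F,\mathcal{L}$ is an $x\in T_X$ with $\mathcal{L}(F,T)(x)\neq c^*(x)$. *)

(* Defs.v *)
From mathcomp Require Import all_boot all_order all_algebra finmap.
From mathcomp Require Import boolp classical_sets functions cardinality reals.

Set Implicit Arguments.
Unset Strict Implicit.
Unset Printing Implicit Defensive.

Local Open Scope classical_set_scope.
Local Open Scope fset_scope.

Section TeachingProtocol.

Context {R : realType} {X Y : Type}.

Record training_set := TrainingSet {
  examples :> set (X * Y);
  examples_finite : finite_set examples }.

Definition objects (T : training_set) : set X := fst @` examples T.

Definition consistent_with (c : X -> Y) (T : training_set) : Prop :=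
  forall x y, examples T (x, y) -> c x = y.

Section Features.

Variable teachable : set (X -> R).

Record feature_set := FeatureSet {
  features :> {fset X -> R};
  features_teachable : forall f, f \in features -> teachable f }.

Record dim_feature_set (d : nat) := DimFeatureSet {
  dim_feature_val :> feature_set;
  dim_feature_card : #|` features dim_feature_val| = d }.

(* The vector (f_1(x), ..., f_d(x)), with the elements f_1, ..., f_d of F taken
   in the order of the duplicate-free enumeration that underlies {fset X -> R};
   since #|` F| = d, the default value of nth is never reached. *)
Definition feature_map d (F : dim_feature_set d) (x : X) : 'rV[R]_d :=
  \row_(i < d) nth (fun=> 0%R) (enum_fset (features F)) i x.

Definition dim_learning_algorithm (d : nat) : Type :=
  dim_feature_set d -> training_set -> 'rV[R]_d -> Y.

Definition hypothesis_space d (l : dim_learning_algorithm d) :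
    set ('rV[R]_d -> Y) :=
  [set h | exists F T, l F T = h].

Definition dim_consistent d (l : dim_learning_algorithm d) : Prop :=
  forall (F : dim_feature_set d) (T : training_set),
    (exists2 h, hypothesis_space l h & consistent_with (h \o feature_map F) T) ->
    consistent_with (l F T \o feature_map F) T.

Definition vector_learning_algorithm : Type :=
  forall d, dim_learning_algorithm d.

Definition consistent_algorithm (l : vector_learning_algorithm) : Prop :=
  forall d, dim_consistent (l d).

Definition own_dim (F : feature_set) : dim_feature_set #|` features F| :=
  DimFeatureSet (erefl #|` features F|).

Definition learned (l : vector_learning_algorithm) (F : feature_set)
    (T : training_set) : X -> Y :=
  l #|` features F| (own_dim F) T \o feature_map (own_dim F).

Definition learnable (l : vector_learning_algorithm) (F : feature_set) :
    set (X -> Y) :=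
  [set c | exists S, learned l F S = c].

Definition prediction_error (cstar : X -> Y) (T : training_set)
    (F : feature_set) (l : vector_learning_algorithm) (x : X) : Prop :=
  objects T x /\ learned l F T x <> cstar x.

Definition representation_error (cstar : X -> Y) (T : training_set)
    (F : feature_set) (l : vector_learning_algorithm) : Prop :=
  forall c, learnable l F c ->
    exists x y, examples T (x, y) /\ c x <> cstar x.

End Features.

Definition mislabeling_error (cstar : X -> Y) (T : training_set) : Prop :=
  exists x y, examples T (x, y) /\ y <> cstar x.

End TeachingProtocol.

Arguments training_set : clear implicits.
Arguments vector_learning_algorithm {R X} Y teachable.

(* Main.v *)
(* If neither kind of error occurs, then every label in T agrees with cstar,
   and some learnable c agrees with cstar on the objects of T.  So c is
   consistent with T; by consistency of the algorithm, so is the function learned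
   from T, which therefore also agrees with cstar on the objects of T. *)
Require Import Defs.
From mathcomp Require Import all_boot all_order all_algebra finmap.
From mathcomp Require Import boolp classical_sets functions cardinality reals.

(** A learnable [c] factors as a hypothesis after the feature map of [F], so it supplies the premise
    of [dim_consistent] at [own_dim F]. *)
Lemma consistent_learned {R : realType} {X Y : Type} {teachable : set (X -> R)}
    {F : feature_set teachable} {T : training_set X Y}
    {l : vector_learning_algorithm Y teachable} {c : X -> Y} :
  consistent_algorithm l -> learnable l F c -> consistent_with c T ->
  consistent_with (learned l F T) T.
Proof.
move=> lC [S <-] cT; apply: lC.
by exists (l _ (own_dim F) S) => //; exists (own_dim F), S.
Qed.

Theorem proposition3 (R : realType) (X Y : Type) (teachable : set (X -> R))
    (cstar : X -> Y) (F : feature_set teachable) (T : training_set X Y)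
    (l : vector_learning_algorithm Y teachable) :
  consistent_algorithm l ->
  (exists x : X, prediction_error cstar T F l x) ->
  mislabeling_error cstar T \/ representation_error cstar T F l.
Proof.
move=> lC [x [[[z y] /= Tzy zx] err]]; subst z.
have [|noML] := pselect (mislabeling_error cstar T); first by left.
have label u v : examples T (u, v) -> v = cstar u.
  by move=> Tuv; apply: contrapT => vN; apply: noML; exists u, v.
(* With [noRE] for this [c], it remains to refute the prediction error: the learned function must be
   shown correct at [z]. *)
right=> c cF; apply: contrapT => noRE; apply: err.
have cT : consistent_with c T.
  move=> u v Tuv; rewrite (label _ _ Tuv).
  by apply: contrapT => cN; apply: noRE; exists u, v.
(* The label [y] links the learned value at [z] to [cstar z]. *)
by rewrite (consistent_learned lC cF cT _ _ Tzy) (label _ _ Tzy).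
Qed.
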